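(* For all lengths $a,b,c$: (irreflexivity) not $a<a$; (transitivity) if $a<b$ and $b<c$ then $a<c$.
   Context: Synthetic plane geometry with classical logic. Primitive notions: points, lines (with equality), incidence $A\in x$, a ternary betweenness relation $\mathrm{Bet}(A,B,C)$ (''$B$ strictly between $A$ and $C$''), a type of lengths with a map $(A,B)\mapsto|AB|$ such that every length equals $|AB|$ for some $A,B$. Points are collinear if some line contains all of them. Axioms: (incidence) there is a point; for every point there is a distinct point; every line has a point; for every line $x$ and $A\in x$ there is $B\in x$, $B\neq A$; for every line there is a point not on it; through two distinct points there is a line; if $A\neq B$, $A,B\in x$ and $x\neq y$ then $A\notin y$ or $B\notin y$. (betweenness) if $\mathrm{Bet}(A,B,C)$ then $A\neq C$, $A,B,C$ collinear, $\mathrm{Bet}(C,B,A)$, and not $\mathrm{Bet}(B,A,C)$. (lengths) $|AB|=|CC|$ iff $A=B$; $|AB|=|BA|$. (line–circle) for $O,A,B$ with $A\neq O$ there is $C$ with ($\mathrm{Bet}(A,O,C)$ or $O=C$) and $|OB|=|OC|$. ''$P,Q$ on opposite sides of line $x$'': $P,Q\notin x$ and some $O\in x$ has $\mathrm{Bet}(P,O,Q)$; ''same side'': $P,Q\notin x$ and no such $O$. (Pasch) if $P,Q$ are on opposite sides of $x$ and $R\notin x$, then $P,R$ or $R,Q$ are on opposite sides of $x$. Write $\mathrm{SR}(O,P,Q)$ for: $O\neq P$, $O\neq Q$, $O,P,Q$ collinear, not $\mathrm{Bet}(P,O,Q)$. (concentric circles) for points $O,A,A',B,B'$: if $\mathrm{Bet}(O,A,B)$,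 $\mathrm{SR}(O,A',B')$, $|OA|=|OA'|$ and $|OB|=|OB'|$, then $\mathrm{Bet}(O,A',B')$ and $|AB|=|A'B'|$. (circle–circle) for points $O,A,B,O',A',B',P$: if $O,O',P$ are not collinear, $\mathrm{Bet}$ holds for each of the triples $(A,A',B),(A,A',B'),(A,B,B'),(A',B,B')$, $\mathrm{Bet}(A,O,B)$ with $|OA|=|OB|$, and $\mathrm{Bet}(A',O',B')$ with $|O'A'|=|O'B'|$, then there is a point $Q$ with $P,Q$ on the same side of the line through $O,O'$, $|OQ|=|OA|$ and $|O'Q|=|O'A'|$. Order: $a<b$ iff there are points $A,B,C$ with $|AB|=a$, $|AC|=b$ and ($\mathrm{Bet}(A,B,C)$ or ($A=B$ and $B\neq C$)). *)

(* Defs.v *)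
Record plane_signature : Type := {
  point : Type;
  line : Type;
  length : Type;
  incident : point -> line -> Prop;
  Bet : point -> point -> point -> Prop;   (* strict: the middle argument is between *)
  dist : point -> point -> length
}.

Arguments incident {_} _ _.
Arguments Bet {_} _ _ _.
Arguments dist {_} _ _.

Definition Collinear {S : plane_signature} (A B C : point S) : Prop :=
  exists x : line S, incident A x /\ incident B x /\ incident C x.

Definition OppositeSides {S : plane_signature} (x : line S) (P Q : point S) : Prop :=
  ~ incident P x /\ ~ incident Q x /\ exists O, incident O x /\ Bet P O Q.

Definition SameSide {S : plane_signature} (x : line S) (P Q : point S) : Prop :=
  ~ incident P x /\ ~ incident Q x /\ ~ (exists O, incident O x /\ Bet P O Q).

(* P and Q lie on one ray issued from O. *)
Definition SR {S : plane_signature} (O P Q : point S) : Prop :=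
  O <> P /\ O <> Q /\ Collinear O P Q /\ ~ Bet P O Q.

Record plane_axioms (S : plane_signature) : Prop := {
  dist_surjective : forall a : length S, exists A B : point S, dist A B = a;

  point_exists : exists A : point S, True;
  distinct_point_exists : forall A : point S, exists B : point S, A <> B;
  line_has_point : forall x : line S, exists A, incident A x;
  line_has_second_point : forall (x : line S) A,
    incident A x -> exists B, incident B x /\ B <> A;
  point_off_line : forall x : line S, exists A, ~ incident A x;
  line_through : forall A B : point S,
    A <> B -> exists x, incident A x /\ incident B x;
  line_unique : forall (A B : point S) (x y : line S),
    A <> B -> incident A x -> incident B x -> x <> y ->
    ~ incident A y \/ ~ incident B y;

  bet_ends_distinct : forall A B C : point S, Bet A B C -> A <> C;
  bet_collinear : forall A B C : point S, Bet A B C -> Collinear A B C;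
  bet_sym : forall A B C : point S, Bet A B C -> Bet C B A;
  bet_exclusive : forall A B C : point S, Bet A B C -> ~ Bet B A C;

  dist_null : forall A B C : point S, dist A B = dist C C <-> A = B;
  dist_sym : forall A B : point S, dist A B = dist B A;

  line_circle : forall O A B : point S,
    A <> O -> exists C, (Bet A O C \/ O = C) /\ dist O B = dist O C;

  pasch : forall (x : line S) (P Q R : point S),
    OppositeSides x P Q -> ~ incident R x ->
    OppositeSides x P R \/ OppositeSides x R Q;

  concentric_circles : forall O A A' B B' : point S,
    Bet O A B -> SR O A' B' ->
    dist O A = dist O A' -> dist O B = dist O B' ->
    Bet O A' B' /\ dist A B = dist A' B';

  (* Non-collinearity of O, O', P forces O <> O', so the line x is unique. *)
  circle_circle : forall O A B O' A' B' P : point S,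
    ~ Collinear O O' P ->
    Bet A A' B -> Bet A A' B' -> Bet A B B' -> Bet A' B B' ->
    Bet A O B -> dist O A = dist O B ->
    Bet A' O' B' -> dist O' A' = dist O' B' ->
    exists Q, (exists x, incident O x /\ incident O' x /\ SameSide x P Q) /\
      dist O Q = dist O A /\ dist O' Q = dist O' A'
}.

Definition length_lt {S : plane_signature} (a b : length S) : Prop :=
  exists A B C : point S,
    dist A B = a /\ dist A C = b /\ (Bet A B C \/ (A = B /\ B <> C)).

(* Main.v *)
(** The congruence axioms only compare segments issued from a common point, so
    an inequality of lengths is first moved from one origin to another as in
    Euclid I.1-I.2: circle-circle gives an apex [T] equidistant from [A] and [D];
    a configuration on the ray extending [TA] beyond [A] is rotated about [T] to
    the ray extending [TD] beyond [D], and the concentric-circle axiom lets one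
    subtract [TA] and [TD].  Transitivity of [<] then reduces to transitivity of
    betweenness on a ray. *)
Require Import Defs.
From Stdlib Require Import Classical.

Section Plane.

Context {S : plane_signature} (HS : plane_axioms S).

(** * Incidence and elementary betweenness *)

Lemma line_eq (A B : point S) (x y : line S) :
  A <> B -> incident A x -> incident B x -> incident A y -> incident B y -> x = y.
Proof.
  intros nAB Ax Bx Ay By. apply NNPP. intros nxy.
  destruct (line_unique S HS A B x y nAB Ax Bx nxy); contradiction.
Qed.

Lemma meet_unique (A B : point S) (x y : line S) :
  x <> y -> incident A x -> incident A y -> incident B x -> incident B y -> A = B.
Proof.
  intros nxy Ax Ay Bx By. apply NNPP. intros nAB.
  apply nxy. exact (line_eq A B x y nAB Ax Bx Ay By).
Qed.

Lemma bet_distinct (A B C : point S) :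
  Bet A B C -> A <> B /\ B <> C /\ A <> C.
Proof.
  intros H. repeat split.
  - intros <-. exact (bet_exclusive S HS _ _ _ H H).
  - intros <-. apply (bet_sym S HS) in H. exact (bet_exclusive S HS _ _ _ H H).
  - exact (bet_ends_distinct S HS _ _ _ H).
Qed.

Lemma bet_exclusive_right (A B C : point S) : Bet A B C -> ~ Bet A C B.
Proof.
  intros H K. apply (bet_sym S HS) in H. apply (bet_sym S HS) in K.
  exact (bet_exclusive S HS _ _ _ H K).
Qed.

Lemma bet_middle_on (A B C : point S) (x : line S) :
  Bet A B C -> incident A x -> incident C x -> incident B x.
Proof.
  intros H Ax Cx. destruct (bet_collinear S HS _ _ _ H) as (y & Ay & By & Cy).
  destruct (bet_distinct _ _ _ H) as (_ & _ & nAC).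
  now rewrite (line_eq A C x y nAC Ax Cx Ay Cy).
Qed.

Lemma bet_end_on (A B C : point S) (x : line S) :
  Bet A B C -> incident A x -> incident B x -> incident C x.
Proof.
  intros H Ax Bx. destruct (bet_collinear S HS _ _ _ H) as (y & Ay & By & Cy).
  destruct (bet_distinct _ _ _ H) as (nAB & _ & _).
  now rewrite (line_eq A B x y nAB Ax Bx Ay By).
Qed.

(** * Pasch's axiom and the order of four points on a line *)

Lemma pasch_bet (x : line S) (P O Q R : point S) :
  Bet P O Q -> incident O x -> ~ incident P x -> ~ incident R x ->
  (exists M, incident M x /\ Bet P M R) \/ (exists M, incident M x /\ Bet R M Q).
Proof.
  intros H Ox nP nR.
  assert (nQ : ~ incident Q x).
  { intros Qx. apply nP. exact (bet_end_on _ _ _ _ (bet_sym S HS _ _ _ H) Qx Ox). }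
  assert (opp : OppositeSides x P Q) by (split; [|split]; eauto).
  destruct (pasch S HS x P Q R opp nR) as [(_ & _ & K) | (_ & _ & K)]; auto.
Qed.

(** Pasch for a degenerate triangle: an auxiliary line through [B] and a point off [l] meets [l]
    only in [B], so whichever side it crosses, it crosses at [B]. The transitivity laws below come
    from this dichotomy by excluding one case. *)
Lemma pasch_on_line (l : line S) (A B C D : point S) :
  Bet A B C -> incident A l -> incident B l -> incident D l -> D <> B ->
  Bet A B D \/ Bet D B C.
Proof.
  intros H Al Bl Dl nDB.
  assert (Cl := bet_end_on _ _ _ _ H Al Bl).
  destruct (bet_distinct _ _ _ H) as (nAB & _ & _).
  destruct (point_off_line S HS l) as [P nP].
  destruct (line_through S HS B P) as (x & Bx & Px).
  { intros <-. contradiction. }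
  assert (nxl : x <> l) by (intros ->; contradiction).
  assert (off : forall Q, incident Q l -> Q <> B -> ~ incident Q x).
  { intros Q Ql nQB Qx. apply nQB. exact (meet_unique Q B x l nxl Qx Ql Bx Bl). }
  destruct (pasch_bet x A B C D H Bx (off A Al nAB) (off D Dl nDB))
    as [(M & Mx & K) | (M & Mx & K)].
  - left. rewrite (meet_unique B M x l nxl Bx Bl Mx); auto.
    exact (bet_middle_on _ _ _ _ K Al Dl).
  - right. rewrite (meet_unique B M x l nxl Bx Bl Mx); auto.
    exact (bet_middle_on _ _ _ _ K Dl Cl).
Qed.

Lemma bet_trans_outer (A B C D : point S) :
  Bet A B C -> Bet A C D -> Bet B C D /\ Bet A B D.
Proof.
  intros H K.
  destruct (bet_collinear S HS _ _ _ H) as (l & Al & Bl & Cl).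
  assert (Dl := bet_end_on _ _ _ _ K Al Cl).
  destruct (bet_distinct _ _ _ H) as (nAB & nBC & _).
  assert (BCD : Bet B C D).
  { destruct (pasch_on_line l A C D B K Al Cl Bl nBC) as [X | X]; auto.
    now apply bet_exclusive_right in H. }
  split; [exact BCD|].
  destruct (pasch_on_line l A B C D H Al Bl Dl) as [X | X]; auto.
  - intros ->. now apply bet_exclusive_right in H.
  - apply (bet_sym S HS) in X. now apply (bet_exclusive S HS) in BCD.
Qed.

Lemma bet_trans_overlap (A B C D : point S) : Bet A B C -> Bet B C D -> Bet A B D.
Proof.
  intros H K.
  destruct (bet_collinear S HS _ _ _ H) as (l & Al & Bl & Cl).
  assert (Dl := bet_end_on _ _ _ _ K Bl Cl).
  destruct (bet_distinct _ _ _ K) as (_ & _ & nBD).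
  destruct (pasch_on_line l A B C D H Al Bl Dl) as [X | X]; auto.
  apply (bet_sym S HS) in X. now apply (bet_exclusive S HS) in K.
Qed.

Lemma bet_trans_inner (A B C D : point S) : Bet A B D -> Bet B C D -> Bet A C D.
Proof.
  intros H K.
  destruct (bet_collinear S HS _ _ _ H) as (l & Al & Bl & Dl).
  assert (Cl := bet_middle_on _ _ _ _ K Bl Dl).
  destruct (bet_distinct _ _ _ K) as (nBC & _ & _).
  assert (nCBD := bet_exclusive S HS _ _ _ K).
  assert (nAC : A <> C) by (intros ->; contradiction).
  destruct (pasch_on_line l B C D A K Bl Cl Al nAC) as [X | X]; auto.
  apply (bet_sym S HS) in X.
  destruct (pasch_on_line l A B D C H Al Bl Cl) as [Y | Y]; auto; try contradiction.
  now apply bet_exclusive_right in X.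
Qed.

(** * Prolonging segments, trichotomy on a line, and rays *)

Lemma extend_segment (A O B : point S) :
  A <> O -> O <> B -> exists C, Bet A O C /\ dist O C = dist O B.
Proof.
  intros nAO nOB. destruct (line_circle S HS O A B nAO) as (C & [H | <-] & E).
  - exists C. auto.
  - apply (dist_null S HS) in E. contradiction.
Qed.

(** Repeated use of Pasch. With [D] off [l] and [G] beyond [D] on [BD], the lines [AD] and [CD] meet
    the segments [CG] and [AG] in [E] and [F]. Pasch in triangle [AGE] with line [CD] puts [D]
    between [A] and [E]; Pasch in triangle [AEC] with line [BD] then puts [B] between [A] and
    [C]. *)
Lemma bet_total (l : line S) (A B C : point S) :
  A <> B -> B <> C -> A <> C -> incident A l -> incident B l -> incident C l ->
  Bet A B C \/ Bet B A C \/ Bet A C B.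
Proof.
  intros nAB nBC nAC Al Bl Cl.
  destruct (classic (Bet B A C)) as [X | nBAC]; auto.
  destruct (classic (Bet A C B)) as [X | nACB]; auto.
  left.
  destruct (point_off_line S HS l) as [D nDl].
  assert (nDA : A <> D) by (intros ->; contradiction).
  assert (nDB : B <> D) by (intros ->; contradiction).
  assert (nDC : C <> D) by (intros ->; contradiction).
  destruct (extend_segment B D B nDB (not_eq_sym nDB)) as (G & BDG & _).
  destruct (line_through S HS A D nDA) as (p & Ap & Dp).
  destruct (line_through S HS B D nDB) as (r & Br & Dr).
  destruct (line_through S HS C D nDC) as (q & Cq & Dq).
  assert (npl : p <> l) by (intros ->; contradiction).
  assert (nrl : r <> l) by (intros ->; contradiction).
  assert (nql : q <> l) by (intros ->; contradiction).
  assert (Gr := bet_end_on _ _ _ _ BDG Br Dr).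
  assert (onp : forall X, incident X l -> incident X p -> X = A)
    by (intros X Xl Xp; exact (meet_unique X A p l npl Xp Xl Ap Al)).
  assert (onq : forall X, incident X l -> incident X q -> X = C)
    by (intros X Xl Xq; exact (meet_unique X C q l nql Xq Xl Cq Cl)).
  assert (onr : forall X, incident X l -> incident X r -> X = B)
    by (intros X Xl Xr; exact (meet_unique X B r l nrl Xr Xl Br Bl)).
  assert (nBp : ~ incident B p) by (intros X; apply nAB; symmetry; auto).
  assert (nCp : ~ incident C p) by (intros X; apply nAC; symmetry; auto).
  assert (nBq : ~ incident B q) by (intros X; apply nBC; auto).
  assert (nAq : ~ incident A q) by (intros X; apply nAC; auto).
  assert (nAr : ~ incident A r) by (intros X; apply nAB; auto).
  assert (nCr : ~ incident C r) by (intros X; apply nBC; symmetry; auto).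
  destruct (pasch_bet p B D G C BDG Dp nBp nCp) as [(M & Mp & K) | (E & Ep & CEG)].
  (* A crossing of [BC] would be [A] itself, an order already excluded; the same happens with [C]
     for the line [q]. *)
  { rewrite (onp M (bet_middle_on _ _ _ _ K Bl Cl) Mp) in K. contradiction. }
  destruct (pasch_bet q B D G A BDG Dq nBq nAq) as [(M & Mq & K) | (F & Fq & AFG)].
  { rewrite (onq M (bet_middle_on _ _ _ _ K Bl Al) Mq) in K.
    apply (bet_sym S HS) in K. contradiction. }
  assert (npq : p <> q) by (intros ->; contradiction).
  assert (nqr : r <> q) by (intros ->; contradiction).
  assert (nEq : ~ incident E q).
  { intros Eq. rewrite (meet_unique E D p q npq Ep Eq Dp Dq) in CEG.
    apply nCr. exact (bet_end_on _ _ _ _ (bet_sym S HS _ _ _ CEG) Gr Dr). }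
  destruct (bet_collinear S HS _ _ _ CEG) as (s & Cs & Es & Gs).
  assert (nsq : s <> q) by (intros ->; contradiction).
  assert (nsr : s <> r) by (intros ->; contradiction).
  destruct (pasch_bet q A F G E AFG Fq nAq nEq) as [(M & Mq & K) | (M & Mq & K)].
  (* Line [CD] meets line [EG] only in [C], which is not between [E] and [G]. *)
  2:{ rewrite (meet_unique M C s q nsq (bet_middle_on _ _ _ _ K Es Gs) Mq Cs Cq) in K.
      now apply (bet_exclusive S HS) in K. }
  rewrite (meet_unique M D p q npq (bet_middle_on _ _ _ _ K Ap Ep) Mq Dp Dq) in K.
  destruct (pasch_bet r A D E C K Dr nAr nCr) as [(N & Nr & ANC) | (N & Nr & CNE)].
  - now rewrite (onr N (bet_middle_on _ _ _ _ ANC Al Cl) Nr) in ANC.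
  (* Line [BD] meets line [CE] only in [G], which lies outside the segment [CE]. *)
  - rewrite (meet_unique N G s r nsr (bet_middle_on _ _ _ _ CNE Cs Es) Nr Gs Gr) in CNE.
    now apply bet_exclusive_right in CNE.
Qed.

(** By trichotomy one of [X], [A], [B] lies between the other two, and each order is incompatible
    with [O] being inside all three segments. *)
Lemma opposite_rays (X O A B : point S) : Bet X O A -> Bet X O B -> ~ Bet A O B.
Proof.
  intros XA XB AB.
  destruct (bet_collinear S HS _ _ _ XA) as (l & Xl & Ol & Al).
  assert (Bl := bet_end_on _ _ _ _ XB Xl Ol).
  destruct (bet_distinct _ _ _ XA) as (_ & _ & nXA).
  destruct (bet_distinct _ _ _ XB) as (_ & _ & nXB).
  destruct (bet_distinct _ _ _ AB) as (_ & _ & nAB).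
  destruct (bet_total l X A B nXA nAB nXB Xl Al Bl) as [H | [H | H]].
  - destruct (bet_trans_outer _ _ _ _ XA H) as [K _].
    now apply (bet_exclusive S HS) in K.
  - destruct (bet_trans_outer _ _ _ _ (bet_sym S HS _ _ _ XA) H) as [K _].
    now apply (bet_exclusive S HS) in K.
  - destruct (bet_trans_outer _ _ _ _ XB H) as [K _].
    apply (bet_sym S HS) in K. now apply bet_exclusive_right in K.
Qed.

Lemma SR_opposite (X O A B : point S) : Bet X O A -> Bet X O B -> SR O A B.
Proof.
  intros XA XB.
  destruct (bet_collinear S HS _ _ _ XA) as (l & Xl & Ol & Al).
  destruct (bet_distinct _ _ _ XA) as (_ & nOA & _).
  destruct (bet_distinct _ _ _ XB) as (_ & nOB & _).
  repeat split; auto.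
  - exists l. repeat split; auto. exact (bet_end_on _ _ _ _ XB Xl Ol).
  - exact (opposite_rays _ _ _ _ XA XB).
Qed.

Lemma SR_bet (O A B : point S) : Bet O A B -> SR O A B /\ SR O B A.
Proof.
  intros H.
  destruct (bet_collinear S HS _ _ _ H) as (l & Ol & Al & Bl).
  destruct (bet_distinct _ _ _ H) as (nOA & _ & nOB).
  assert (nAOB := bet_exclusive S HS _ _ _ H).
  split; repeat split; auto; try (exists l; auto).
  intros K. apply (bet_sym S HS) in K. contradiction.
Qed.

(** Line-circle measures only on the ray opposite to a given point, so the direction is reversed
    twice: [X] is opposite to [A], and [L] opposite to [X]. *)
Lemma layoff (O A B : point S) :
  O <> A -> O <> B -> exists L, SR O A L /\ dist O L = dist O B.
Proof.
  intros nOA nOB.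
  destruct (extend_segment A O A (not_eq_sym nOA) nOA) as (X & AOX & _).
  destruct (bet_distinct _ _ _ AOX) as (_ & nOX & _).
  destruct (extend_segment X O B (not_eq_sym nOX) nOB) as (L & XOL & E).
  exists L. split; [|exact E].
  exact (SR_opposite X O A L (bet_sym S HS _ _ _ AOX) XOL).
Qed.

(** * Transport of segments to another origin *)

Lemma isosceles_apex (A D : point S) :
  A <> D -> exists T, T <> A /\ T <> D /\ dist T A = dist T D.
Proof.
  intros nAD.
  destruct (line_through S HS A D nAD) as (l & Al & Dl).
  destruct (point_off_line S HS l) as [P nP].
  destruct (extend_segment D A D (not_eq_sym nAD) nAD) as (U & DAU & EU).
  destruct (extend_segment A D A nAD (not_eq_sym nAD)) as (V & ADV & EV).
  assert (nADP : ~ Collinear A D P).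
  { intros (x & Ax & Dx & Px). apply nP.
    now rewrite (line_eq A D l x nAD Al Dl Ax Dx). }
  assert (UAD := bet_sym S HS _ _ _ DAU).
  assert (UAV := bet_trans_overlap _ _ _ _ UAD ADV).
  assert (UDV := bet_trans_inner _ _ _ _ UAV ADV).
  (* In the order [U], [A], [D], [V], the segment [UD] is a diameter of the circle about [A] through
     [D], and [AV] one of the circle about [D] through [A]. They interlace, so [T] is the apex of an
     equilateral triangle on [AD]. *)
  destruct (circle_circle S HS A U D D A V P nADP UAD UAV UDV ADV UAD EU ADV (eq_sym EV))
    as (T & (x & Ax & Dx & _ & nTx & _) & EA & ED).
  exists T. repeat split.
  - intros ->. contradiction.
  - intros ->. contradiction.
  - rewrite (dist_sym S HS T A), (dist_sym S HS T D), EA, ED, EU.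
    apply (dist_sym S HS).
Qed.

Lemma bet_transport (A B C D : point S) :
  Bet A B C ->
  exists E F, Bet D E F /\ dist D E = dist A B /\ dist D F = dist A C.
Proof.
  intros ABC.
  destruct (classic (A = D)) as [<- | nAD]; [now exists B, C|].
  destruct (bet_distinct _ _ _ ABC) as (nAB & _ & nAC).
  destruct (isosceles_apex A D nAD) as (T & nTA & nTD & TA_TD).
  destruct (extend_segment T A B nTA nAB) as (B1 & TAB & EB).
  destruct (extend_segment T A C nTA nAC) as (C1 & TAC & EC).
  destruct (concentric_circles S HS A B B1 C C1 ABC (SR_opposite _ _ _ _ TAB TAC)
              (eq_sym EB) (eq_sym EC)) as [AB1C1 _].
  destruct (bet_distinct _ _ _ TAB) as (_ & _ & nTB).
  destruct (bet_distinct _ _ _ TAC) as (_ & _ & nTC).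
  destruct (layoff T D B1 nTD nTB) as (E & RE & EE).
  destruct (concentric_circles S HS T A D B1 E TAB RE TA_TD (eq_sym EE)) as [TDE DE].
  destruct (bet_distinct _ _ _ TDE) as (_ & _ & nTE).
  (* Laying [F] off along [TE] makes the comparison with [T], [B1], [C1] yield the order [T], [E],
     [F], hence [D], [E], [F]. *)
  destruct (layoff T E C1 nTE nTC) as (F & RF & EF).
  assert (TB1C1 : Bet T B1 C1).
  { apply (bet_sym S HS).
    apply (bet_trans_overlap _ _ A); now apply (bet_sym S HS). }
  destruct (concentric_circles S HS T B1 E C1 F TB1C1 RF (eq_sym EE) (eq_sym EF))
    as [TEF _].
  destruct (bet_trans_outer _ _ _ _ TDE TEF) as [DEF TDF].
  destruct (concentric_circles S HS T A D C1 F TAC (proj1 (SR_bet _ _ _ TDF)) TA_TD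
              (eq_sym EF)) as [_ DF].
  exists E, F. split; [exact DEF | split; congruence].
Qed.

(** * The strict order of lengths *)

Lemma length_lt_irrefl (a : length S) : ~ length_lt a a.
Proof.
  intros (A & B & C & EB & EC & [ABC | [<- nAC]]).
  - assert (E : dist A B = dist A C) by congruence.
    (* If [AB] and [AC] are equal, [B] and [C] can be exchanged in the concentric-circle axiom,
       which reverses their order on the ray. *)
    destruct (concentric_circles S HS A B C C B ABC (proj2 (SR_bet _ _ _ ABC)) E (eq_sym E))
      as [ACB _].
    now apply bet_exclusive_right in ACB.
  - apply nAC, (dist_null S HS A C A). congruence.
Qed.

Lemma length_lt_trans (a b c : length S) : length_lt a b -> length_lt b c -> length_lt a c.
Proof.
  intros (A & B & C & EA & EB & ABC) (D & E & F & ED & EF & DEF).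
  assert (nAC : A <> C).
  { destruct ABC as [H | [<- H]]; [exact (bet_ends_distinct S HS _ _ _ H) | exact H]. }
  destruct DEF as [DEF | [<- nDF]].
  2:{ exfalso. apply nAC, (dist_null S HS A C D). congruence. }
  destruct (bet_distinct _ _ _ DEF) as (_ & _ & nDF).
  destruct ABC as [ABC | [<- _]].
  - destruct (bet_transport A B C D ABC) as (B' & C' & DBC & EB' & EC').
    (* The transported points may lie on another ray from [D] than [E] and [F], so [F] is copied to
       [F'] on the ray of [C'], where [C'] plays the part of [E]. *)
    destruct (bet_distinct _ _ _ DBC) as (_ & _ & nDC).
    destruct (layoff D C' F nDC nDF) as (F' & RF & EF').
    assert (E' : dist D E = dist D C') by congruence.
    destruct (concentric_circles S HS D E C' F F' DEF RF E' (eq_sym EF')) as [DCF _].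
    destruct (bet_trans_outer _ _ _ _ DBC DCF) as [_ DBF].
    exists D, B', F'. repeat split; [congruence | congruence | auto].
  (* Here [a] is the null length, which is the same at every point. *)
  - exists D, D, F. repeat split; auto.
    rewrite <- EA. symmetry. now apply (dist_null S HS).
Qed.

End Plane.

Theorem theorem16 (S : plane_signature) (HS : plane_axioms S) :
  (forall a : length S, ~ length_lt a a) /\
  (forall a b c : length S, length_lt a b -> length_lt b c -> length_lt a c).
Proof. split; [exact (length_lt_irrefl HS) | exact (length_lt_trans HS)]. Qed.
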